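(* Let $\mathcal{K}$ be a class of pairs $(S,\phi)$, with $S\subseteq\mathcal{L}$ finite and $\phi\in\mathcal{L}$, for which $S\models\phi$ can be decided in polynomial time. Consider finite default theories $\langle D,W\rangle$ with a strict total order $\mathcal{T}$ on $D$ such that all the logical consequence tests (tests of membership in $Cn(E_i)$) arising in the definition of $\mathcal{T}$-preferred$^{BH}$ extensions are in $\mathcal{K}$; that is, for every candidate $E\subseteq\mathcal{L}$, every set $E_i$ in the sequence associated with $E$ and every $\alpha{:}\beta/\gamma\in D$, the pairs $(E_i,\alpha)$, $(E_i,\neg\beta)$, $(E_i,\gamma)$ belong to $\mathcal{K}$. Then, if $\langle D,W\rangle$ has a $\mathcal{T}$-preferred$^{BH}$ extension, this extension is unique, and it can be computed (represented as $Cn(G)$ for a finite set $G\subseteq\mathcal{L}$) in time polynomial in the size of $\langle D,W\rangle$ and $\mathcal{T}$.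
   Context: $\mathcal{L}$ is the set of formulae of classical propositional logic, $\models$ classical logical consequence, and $Cn(S)=\{\phi\in\mathcal{L}\mid S\models\phi\}$ for $S\subseteq\mathcal{L}$. A default here is a rule $\alpha{:}\beta/\gamma$ with $\alpha,\beta,\gamma\in\mathcal{L}$ (prerequisite $\alpha$, justification $\beta$, conclusion $\gamma$). A default theory is a pair $\langle D,W\rangle$ with $D$ a set of defaults and $W\subseteq\mathcal{L}$; it is finite if $D$ and $W$ are finite, and its size is the sum of the lengths of the formulae in $W$ and in the defaults in $D$. $\delta\mathcal{T}\delta'$ means that $\delta$ has higher priority than $\delta'$. A default $\alpha{:}\beta/\gamma$ is active in $E\subseteq\mathcal{L}$ if $E\models\alpha$, $E\not\models\neg\beta$ and $E\not\models\gamma$. For $E\subseteq\mathcal{L}$ define the sequence associated with $E$ by $E_0=W$ and for all $i\ge 0$, $$E_{i+1}=E_i\cup\{\gamma\mid \alpha{:}\beta/\gamma\in D,\ E_i\models\alpha,\ E\not\models\neg\beta,\ \text{no }\delta\in D\text{ with }\delta\,\mathcal{T}\,(\alpha{:}\beta/\gamma)\text{ is active in }E_i\}.$$ $E$ is a $\mathcal{T}$-preferred$^{BH}$ extension of $\langle D,W\rangle$ if and only if $E=\bigcup_{i\ge 0}Cn(E_i)$. *)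

(* Defs.v *)
From HB Require Import structures.
From mathcomp Require Import all_boot all_order all_algebra.
From mathcomp Require Import boolp classical_sets functions cardinality.

Set Implicit Arguments.
Unset Strict Implicit.
Unset Printing Implicit Defensive.

Local Open Scope classical_set_scope.

(* Formulae are words over a finite alphabet: a propositional variable is a    *)
(* letter indexed by a binary word, and its length counts the index too.       *)
Inductive formula : Type :=
| Var of seq bool
| Top
| Bot
| Not of formula
| And of formula & formula
| Or of formula & formula
| Imp of formula & formula.

Lemma form_eq_dec : comparable formula.
Proof. by rewrite /comparable /decidable; decide equality; exact: eq_comparable. Qed.
HB.instance Definition _ := hasDecEq.Build formula (compareP form_eq_dec).

Fixpoint flength (phi : formula) : nat :=
  match phi with
  | Var w => (size w).+1
  | Top | Bot => 1
  | Not a => (flength a).+1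
  | And a b | Or a b | Imp a b => (flength a + flength b).+1
  end.

Fixpoint sat (v : seq bool -> bool) (phi : formula) : bool :=
  match phi with
  | Var w => v w
  | Top => true
  | Bot => false
  | Not a => ~~ sat v a
  | And a b => sat v a && sat v b
  | Or a b => sat v a || sat v b
  | Imp a b => sat v a ==> sat v b
  end.

Definition entails (S : set formula) (phi : formula) : Prop :=
  forall v, (forall psi, S psi -> sat v psi) -> sat v phi.

Definition Cn (S : set formula) : set formula := [set phi | entails S phi].

Record default : Type := Default { prereq : formula; just : formula; concl : formula }.

Lemma default_eq_dec : comparable default.
Proof. by rewrite /comparable /decidable; decide equality; exact: form_eq_dec. Qed.
HB.instance Definition _ := hasDecEq.Build default (compareP default_eq_dec).

Definition active (E : set formula) (d : default) : Prop :=
  [/\ entails E (prereq d), ~ entails E (Not (just d)) & ~ entails E (concl d)].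

(* Throughout, [T d d'] means that [d] has higher priority than [d']. *)
Section Extensions.
Variables (D : set default) (W : set formula) (T : default -> default -> Prop).

Fixpoint stage (E : set formula) (i : nat) : set formula :=
  match i with
  | 0 => W
  | j.+1 => stage E j `|`
      [set g | exists d, [/\ D d, concl d = g,
                            entails (stage E j) (prereq d),
                            ~ entails E (Not (just d)) &
                            ~ exists d', [/\ D d', T d' d & active (stage E j) d']]]
  end.

Definition preferred_BH (E : set formula) : Prop :=
  E = \bigcup_i Cn (stage E i).

Definition strict_total_order_on : Prop :=
  [/\ forall d d', T d d' -> D d /\ D d',
      forall d, ~ T d d,
      forall d1 d2 d3, T d1 d2 -> T d2 d3 -> T d1 d3 &
      forall d d', D d -> D d' -> d <> d' -> T d d' \/ T d' d].

Definition tests_in (K : set (set formula * formula)) : Prop :=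
  forall (E : set formula) (i : nat) (d : default), D d ->
    [/\ K (stage E i, prereq d), K (stage E i, Not (just d)) & K (stage E i, concl d)].

End Extensions.

(* Model of computation: the WHILE language over binary trees, in which every  *)
(* evaluation of an expression is charged the number of nodes of the values of *)
(* all its subexpressions. One step of a program can therefore be carried out  *)
(* by a Turing machine in time polynomial in its charge (trees being stored as *)
(* strings), and conversely a Turing machine step is a constant number of      *)
(* assignments to variables holding the two halves of each tape; so polynomial *)
(* time here is polynomial time on Turing machines.                            *)
Inductive tree : Type := Leaf | Node of tree & tree.

Lemma tree_eq_dec : comparable tree.
Proof. by rewrite /comparable /decidable; decide equality. Qed.
HB.instance Definition _ := hasDecEq.Build tree (compareP tree_eq_dec).

Fixpoint tsize (t : tree) : nat :=
  if t is Node l r then (tsize l + tsize r).+1 else 1.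

Definition tleft (t : tree) : tree := if t is Node l _ then l else Leaf.
Definition tright (t : tree) : tree := if t is Node _ r then r else Leaf.

Definition enc_bool (b : bool) : tree := if b then Node Leaf Leaf else Leaf.

Inductive expr : Type :=
| EVar of nat
| ELeaf
| ENode of expr & expr
| ELeft of expr
| ERight of expr
| EEq of expr & expr.

Inductive cmd : Type :=
| Skip
| Assign of nat & expr
| Seq of cmd & cmd
| If of expr & cmd & cmd
| While of expr & cmd.

Definition store := nat -> tree.

Definition upd (s : store) (x : nat) (t : tree) : store :=
  fun y => if y == x then t else s y.

Fixpoint eval (s : store) (e : expr) : tree :=
  match e with
  | EVar x => s x
  | ELeaf => Leaf
  | ENode a b => Node (eval s a) (eval s b)
  | ELeft a => tleft (eval s a)
  | ERight a => tright (eval s a)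
  | EEq a b => enc_bool (eval s a == eval s b)
  end.

Fixpoint cost (s : store) (e : expr) : nat :=
  tsize (eval s e) +
  match e with
  | EVar _ | ELeaf => 0
  | ELeft a | ERight a => cost s a
  | ENode a b | EEq a b => cost s a + cost s b
  end.

(* [exec c s s' t]: started in store [s], [c] halts in store [s'] in time [t]. *)
Inductive exec : cmd -> store -> store -> nat -> Prop :=
| ExecSkip s : exec Skip s s 1
| ExecAssign s x e : exec (Assign x e) s (upd s x (eval s e)) (cost s e)
| ExecSeq c1 c2 s s1 s2 t1 t2 :
    exec c1 s s1 t1 -> exec c2 s1 s2 t2 -> exec (Seq c1 c2) s s2 (t1 + t2)
| ExecIfTrue e c1 c2 s s' t :
    eval s e != Leaf -> exec c1 s s' t -> exec (If e c1 c2) s s' (cost s e + t)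
| ExecIfFalse e c1 c2 s s' t :
    eval s e = Leaf -> exec c2 s s' t -> exec (If e c1 c2) s s' (cost s e + t)
| ExecWhileTrue e c s s1 s2 t1 t2 :
    eval s e != Leaf -> exec c s s1 t1 -> exec (While e c) s1 s2 t2 ->
    exec (While e c) s s2 (cost s e + t1 + t2)
| ExecWhileFalse e c s : eval s e = Leaf -> exec (While e c) s s (cost s e).

(* Input and output are held by variable 0; the other variables start at Leaf. *)
Definition computes_within (p : cmd) (input output : tree) (bound : nat) : Prop :=
  exists s t, [/\ exec p (upd (fun=> Leaf) 0 input) s t, s 0 = output & t <= bound].

Definition enc_seq (A : Type) (enc : A -> tree) (l : seq A) : tree :=
  foldr (fun a => Node (enc a)) Leaf l.

Definition enc_nat (n : nat) : tree := iter n (Node Leaf) Leaf.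

Definition enc_pair (A B : Type) (ea : A -> tree) (eb : B -> tree) (x : A * B) : tree :=
  Node (ea x.1) (eb x.2).

Fixpoint enc_form (phi : formula) : tree :=
  match phi with
  | Var w => Node (enc_nat 0) (enc_seq enc_bool w)
  | Top => Node (enc_nat 1) Leaf
  | Bot => Node (enc_nat 2) Leaf
  | Not a => Node (enc_nat 3) (enc_form a)
  | And a b => Node (enc_nat 4) (Node (enc_form a) (enc_form b))
  | Or a b => Node (enc_nat 5) (Node (enc_form a) (enc_form b))
  | Imp a b => Node (enc_nat 6) (Node (enc_form a) (enc_form b))
  end.

Definition enc_default (d : default) : tree :=
  Node (enc_form (prereq d)) (Node (enc_form (just d)) (enc_form (concl d))).

(* A finite set is presented to a program as a list without repetitions; the   *)
(* order on defaults is presented as the list of its pairs.                    *)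
Definition enc_forms (l : seq formula) : tree := enc_seq enc_form l.

Definition enc_theory (D : seq default) (W : seq formula) (T : seq (default * default)) : tree :=
  Node (enc_seq enc_default D)
       (Node (enc_forms W) (enc_seq (enc_pair enc_default enc_default) T)).

Definition forms_size (W : seq formula) : nat := \sum_(phi <- W) flength phi.

Definition default_size (d : default) : nat :=
  flength (prereq d) + flength (just d) + flength (concl d).

Definition theory_size (D : seq default) (W : seq formula) : nat :=
  forms_size W + \sum_(d <- D) default_size d.

Definition order_size (T : seq (default * default)) : nat :=
  \sum_(x <- T) (default_size x.1 + default_size x.2).

(* Decidability in polynomial time of a promise problem: nothing is required   *)
(* of the program on pairs outside [K], not even termination.                  *)
Definition ptime_entailment (K : set (set formula * formula)) : Prop :=
  exists (p : cmd) (q : {poly nat}), forall (S : seq formula) (phi : formula),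
    uniq S -> K ([set` S], phi) ->
    exists2 b : bool, (b <-> entails [set` S] phi) &
      computes_within p (enc_pair enc_forms enc_form (S, phi)) (enc_bool b)
        (q.[(forms_size S + flength phi)%N])%R.

(* The order relation listed by [T]. *)
Definition rel_of (T : seq (default * default)) (d d' : default) : Prop := (d, d') \in T.

Definition K_instance (K : set (set formula * formula))
    (D : seq default) (W : seq formula) (T : seq (default * default)) : Prop :=
  [/\ uniq D, uniq W, uniq T,
      strict_total_order_on [set` D] (rel_of T) &
      tests_in [set` D] [set` W] (rel_of T) K].

(* Main.v *)
Require Import Defs.
From mathcomp Require Import all_boot all_order all_algebra zify.
From mathcomp Require Import boolp classical_sets functions cardinality.
Set Implicit Arguments.
Unset Strict Implicit.
Unset Printing Implicit Defensive.
Local Open Scope classical_set_scope.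

(* Let E be a preferred extension. At each stage E_i the topmost active default
   is not blocked by E, for otherwise the stages would stop growing before
   refuting its justification; every other default that fires there has a
   conclusion already entailed by E_i. Hence, up to equivalence, the stages of E do
   not depend on E, and they become stationary after |D| steps.

   An algorithm may query only the stages of actual candidates, and E is not known
   in advance. If E' is any candidate equivalent to E_k, then the stages of E' are
   equivalent to those of E up to index k + 1. So put F_0 = W and let F_(k+1) be
   the stage k + 1 of the candidate F_k: then F_k is equivalent to E_k, every query
   is about a stage of some F_k, and E = Cn(F_|D|), whence also uniqueness.

   Programs are built by closure properties of the families of tree functions
   computable in time polynomial in the size of their argument: composition,
   pairing, conditionals, and folds over lists with polynomially bounded
   accumulators. A promise on the index of the family records that the entailment
   program is called only on pairs of K. *)

(* [tsize] of the tuple library would otherwise take precedence. *)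
Local Notation tsize := Defs.tsize.

(** * Stages of a preferred extension *)

Lemma entailsS S S' phi : S `<=` Cn S' -> entails S phi -> entails S' phi.
Proof. by move=> sub h v mv; apply: h => psi /sub; apply. Qed.

Lemma sub_Cn S : S `<=` Cn S.
Proof. by move=> phi Sphi v; apply. Qed.

Lemma Cn_eq S S' : S `<=` Cn S' -> S' `<=` Cn S -> Cn S = Cn S'.
Proof.
by move=> h h'; apply/seteqP; split=> phi /=; apply: entailsS.
Qed.

Lemma entails_Cn S S' phi : Cn S = Cn S' -> entails S phi -> entails S' phi.
Proof. by move=> h; change (Cn S phi -> Cn S' phi); rewrite h. Qed.

Section Extensions.
Variables (D : set default) (W : set formula) (T : default -> default -> Prop).
Hypothesis T_order : strict_total_order_on D T.

Definition topmost (S : set formula) (d : default) : Prop :=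
  ~ exists d', [/\ D d', T d' d & active S d'].

(** The candidate [E] and the current set [S] are separate arguments because the steps of different
    candidates are compared at equivalent sets. *)
Definition succ_stage (E S : set formula) : set formula :=
  S `|` [set g | exists d, [/\ D d, concl d = g, entails S (prereq d),
                              ~ entails E (Not (just d)) & topmost S d]].

Lemma stageS E j : stage D W T E j.+1 = succ_stage E (stage D W T E j).
Proof. by []. Qed.

Lemma active_Cn S S' d : Cn S = Cn S' -> active S d -> active S' d.
Proof.
move=> h [h1 h2 h3]; split; first exact: entails_Cn h1.
  by move=> h4; apply: h2; apply: entails_Cn h4.
by move=> h4; apply: h3; apply: entails_Cn h4.
Qed.

Lemma topmost_Cn S S' d : Cn S = Cn S' -> topmost S d -> topmost S' d.
Proof.
by move=> h top [d' [h1 h2 h3]]; apply: top; exists d'; split=> //; apply: active_Cn h3.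
Qed.

(** A default whose conclusion [S] already entails adds nothing up to equivalence, so only a default
    with a new conclusion must also be unblocked by [E']. *)
Lemma succ_stage_sub E E' S S' : Cn S = Cn S' ->
  (forall d, D d -> entails S (prereq d) -> ~ entails E (Not (just d)) -> topmost S d ->
     ~ entails S (concl d) -> ~ entails E' (Not (just d))) ->
  succ_stage E S `<=` Cn (succ_stage E' S').
Proof.
move=> h hE phi [Sphi|[d [Dd <- pre nE top]]].
  apply: (@entailsS S'); first by move=> psi ?; apply: sub_Cn; left.
  by apply: (entails_Cn h); apply: sub_Cn.
case: (pselect (entails S (concl d))) => [c|nc].
  apply: (@entailsS S'); first by move=> psi ?; apply: sub_Cn; left.
  exact: entails_Cn h c.
apply: sub_Cn; right; exists d; split=> //.
- exact: entails_Cn pre.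
- exact: hE.
- exact: topmost_Cn top.
Qed.

Lemma succ_stage_Cn E S S' : Cn S = Cn S' -> Cn (succ_stage E S) = Cn (succ_stage E S').
Proof. by move=> h; apply: Cn_eq; apply: succ_stage_sub. Qed.

Lemma stage_mono E i j : i <= j -> stage D W T E i `<=` stage D W T E j.
Proof.
move=> /subnK <-; elim: (j - i) => [|n IH] //=.
by move=> phi h; left; apply: IH.
Qed.

Lemma stage_stable E i j : i <= j ->
  Cn (stage D W T E i.+1) = Cn (stage D W T E i) ->
  Cn (stage D W T E j) = Cn (stage D W T E i).
Proof.
move=> /subnK <- h; elim: (j - i) => [|n IH] //.
by rewrite addSn stageS (succ_stage_Cn E IH).
Qed.

Section Preferred.
Variable E : set formula.
Hypothesis prefE : preferred_BH D W T E.

Lemma stage_sub_ext i : stage D W T E i `<=` Cn E.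
Proof. by move=> phi h; apply: sub_Cn; rewrite prefE; exists i => //; apply: sub_Cn. Qed.

Lemma ext_stable i : Cn (stage D W T E i.+1) = Cn (stage D W T E i) ->
  E = Cn (stage D W T E i).
Proof.
move=> h; rewrite {1}prefE; apply/seteqP; split=> phi; last by exists i.
move=> [j _ hj]; rewrite -(stage_stable (leq_maxl i j) h).
by apply: entailsS hj => psi hpsi; apply: sub_Cn; apply: stage_mono hpsi; apply: leq_maxr.
Qed.

(* Were its justification refuted by [E], the topmost active default would stay
   active and block all the others, so the stages would stop growing before
   refuting it. *)
Lemma topmost_active_unblocked i d :
  D d -> active (stage D W T E i) d -> topmost (stage D W T E i) d ->
  ~ entails E (Not (just d)).
Proof.
case: T_order => _ _ _ total Dd act top blocked.
have stable : Cn (stage D W T E i.+1) = Cn (stage D W T E i).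
  apply: Cn_eq; last by move=> psi ?; apply: sub_Cn; left.
  move=> psi [|[d' [Dd' <- pre nE top']]]; first exact: sub_Cn.
  (* A default [d'] contributing a new formula is either [d], which [E] blocks, or below [d], hence
     held back by it, or above [d] and then itself active, against [top]. *)
  apply: contrapT => nc.
  case: (pselect (d = d')) => [e|ne]; first by apply: nE; rewrite -e.
  case: (total _ _ Dd Dd' ne) => lt; first by apply: top'; exists d.
  apply: top; exists d'; split=> //; split=> // nb; apply: nE.
  by apply: entailsS nb; apply: stage_sub_ext.
move: blocked; rewrite (ext_stable stable) => blocked.
by case: act => _ + _; apply; apply: entailsS blocked => psi.
Qed.

(** As [E] entails [E'], a default that fires for [E] is not refuted by [E']. Conversely, in the
    step from [j] to [j + 1], a default firing for [E'] with a new conclusion is topmost and active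
    in stage [j] of [E], because [j <= k] makes that stage a consequence of [E']; hence [E] does not
    block it. *)
Lemma stage_approx k E' j : Cn E' = Cn (stage D W T E k) -> j <= k.+1 ->
  Cn (stage D W T E' j) = Cn (stage D W T E j).
Proof.
move=> hE'; elim: j => [|j IH] // lt_jk.
have E'E phi : entails E' phi -> entails E phi.
  by move=> /(entails_Cn hE'); apply: entailsS; apply: stage_sub_ext.
have eqj := IH (ltnW lt_jk).
rewrite !stageS; apply: Cn_eq; apply: succ_stage_sub => // d Dd pre nb top nc.
  have top' := topmost_Cn eqj top.
  apply: (@topmost_active_unblocked j) => //; split.
  - exact: entails_Cn pre.
  - move=> b; apply: nb; apply: (entails_Cn (esym hE')); apply: entailsS b => psi h.
    by apply: sub_Cn; apply: stage_mono h.
  - by move=> c; apply: nc; apply: entails_Cn c.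
by move=> /E'E.
Qed.

End Preferred.
End Extensions.

Lemma count_lt (A : eqType) (a b : pred A) (l : seq A) (x : A) :
  subpred a b -> x \in l -> ~~ a x -> b x -> count a l < count b l.
Proof.
move=> ab + nax bx; elim: l => [|y l IH] //=; rewrite inE => /orP[/eqP<-|/IH lt].
  by rewrite (negPf nax) bx add0n add1n ltnS; apply: sub_count.
rewrite -addnS leq_add //; case: (a y) (ab y) => // h.
by rewrite h.
Qed.

(** Until the stages become stationary, each step entails the conclusion of at least one more
    default, which can happen at most [size D] times. *)
Lemma ext_stage_size (D : seq default) W T E : preferred_BH [set` D] W T E ->
  E = Cn (stage [set` D] W T E (size D)).
Proof.
move=> prefE; set S := stage _ _ _ _; apply: ext_stable => //.
apply: contrapT => unstable.
pose n i := count (fun d => `[< entails (S i) (concl d) >]) D.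
(* At [i = size D + 1] the claim exceeds the number of defaults. *)
suff h i : i <= (size D).+1 -> i <= n i.
  by have := leq_trans (h _ (leqnn _)) (count_size _ _); rewrite ltnn.
elim: i => [|i IH] // le_i.
apply: leq_ltn_trans (IH (ltnW le_i)) _.
have mono phi : entails (S i) phi -> entails (S i.+1) phi.
  by apply: entailsS => psi ?; apply: sub_Cn; left.
(* If no conclusion were new at step [i], the stages would be stationary from [i] on, in particular
   at [size D]. *)
have [d Dd [nc c]] : exists2 d, d \in D &
    ~ entails (S i) (concl d) /\ entails (S i.+1) (concl d).
  apply: contrapT => none; apply: unstable.
  have st : Cn (S i.+1) = Cn (S i).
    apply: Cn_eq; last by move=> psi ?; apply: mono; apply: sub_Cn.
    move=> psi h; apply: contrapT => nc; case: (h) => [/sub_Cn //|[d [Dd e _ _ _]]].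
    by apply: none; exists d => //; rewrite e; split=> //; apply: sub_Cn.
  have leiD : i <= size D by rewrite -ltnS.
  by rewrite (stage_stable (leqW leiD) st) (stage_stable leiD st).
apply: (@count_lt _ _ _ _ d) => //; first by move=> x /asboolP/mono/asboolP.
  exact/asboolP.
exact/asboolP.
Qed.

(** * Polynomial time functions on trees *)

Lemma tsize_gt0 t : 0 < tsize t.
Proof. by case: t. Qed.

Lemma tsize_eval s e : tsize (eval s e) <= cost s e.
Proof. by case: e => *; apply: leq_addr. Qed.

Lemma Node_neq_Leaf a b : Node a b != Leaf.
Proof. exact/eqP. Qed.

(** An assignment is charged the size of the value it stores, so no variable grows by more than the
    elapsed time. *)
Lemma exec_tsize c s s' t x : exec c s s' t -> tsize (s' x) <= tsize (s x) + t.
Proof.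
elim=> {c s s' t} [s|s y e|||||]; try by move=> *; lia.
by rewrite /upd; case: eqP => _; have := tsize_eval s e; lia.
Qed.

Lemma exec_eq c s s' t t' : exec c s s' t -> t = t' -> exec c s s' t'.
Proof. by move=> h <-. Qed.

(** * Programs as subroutines *)

Fixpoint shift_expr (e : expr) : expr :=
  match e with
  | EVar x => EVar x.+4
  | ELeaf => ELeaf
  | ENode a b => ENode (shift_expr a) (shift_expr b)
  | ELeft a => ELeft (shift_expr a)
  | ERight a => ERight (shift_expr a)
  | EEq a b => EEq (shift_expr a) (shift_expr b)
  end.

Fixpoint shift_cmd (c : cmd) : cmd :=
  match c with
  | Skip => Skip
  | Assign x e => Assign x.+4 (shift_expr e)
  | Seq c1 c2 => Seq (shift_cmd c1) (shift_cmd c2)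
  | If e c1 c2 => If (shift_expr e) (shift_cmd c1) (shift_cmd c2)
  | While e c => While (shift_expr e) (shift_cmd c)
  end.

Fixpoint expr_bound (e : expr) : nat :=
  match e with
  | EVar x => x.+1
  | ELeaf => 0
  | ENode a b | EEq a b => maxn (expr_bound a) (expr_bound b)
  | ELeft a | ERight a => expr_bound a
  end.

Fixpoint cmd_bound (c : cmd) : nat :=
  match c with
  | Skip => 0
  | Assign x e => maxn x.+1 (expr_bound e)
  | Seq c1 c2 => maxn (cmd_bound c1) (cmd_bound c2)
  | If e c1 c2 => maxn (expr_bound e) (maxn (cmd_bound c1) (cmd_bound c2))
  | While e c => maxn (expr_bound e) (cmd_bound c)
  end.

Section Shift.
Variable m : nat.
Implicit Types r s : store.

Definition shifted r s := forall x, x < m -> r x.+4 = s x.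

Lemma eval_shift r s e : shifted r s -> expr_bound e <= m ->
  eval r (shift_expr e) = eval s e /\ cost r (shift_expr e) = cost s e.
Proof.
move=> rs; elim: e => [x||a IHa b IHb|a IHa|a IHa|a IHa b IHb] /=.
- by move=> /rs ->.
- by [].
- by rewrite geq_max => /andP[/IHa[-> ->] /IHb[-> ->]].
- by move=> /IHa[-> ->].
- by move=> /IHa[-> ->].
- by rewrite geq_max => /andP[/IHa[-> ->] /IHb[-> ->]].
Qed.

Lemma exec_shift c s s' t r : exec c s s' t -> shifted r s -> cmd_bound c <= m ->
  exists r', [/\ exec (shift_cmd c) r r' t, shifted r' s' & forall x, x < 4 -> r' x = r x].
Proof.
move=> h; elim: h r => {c s s' t} /=.
- by move=> s r rs _; exists r; split=> //; apply: ExecSkip.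
- move=> s x e r rs; rewrite geq_max => /andP[xm em].
  have [ev co] := eval_shift rs em.
  exists (upd r x.+4 (eval r (shift_expr e))); split.
  + by rewrite -co; apply: ExecAssign.
  + by move=> y ym; rewrite /upd ev !eqSS; case: eqP => // _; apply: rs.
  + by case=> [|[|[|[|y]]]].
- move=> c1 c2 s s1 s2 t1 t2 _ IH1 _ IH2 r rs; rewrite geq_max => /andP[b1 b2].
  have [r1 [e1 rs1 f1]] := IH1 _ rs b1; have [r2 [e2 rs2 f2]] := IH2 _ rs1 b2.
  exists r2; split=> //; first exact: ExecSeq e1 e2.
  by move=> x x4; rewrite f2 // f1.
- move=> e c1 c2 s s' t h _ IH r rs; rewrite !geq_max => /and3P[be b1 b2].
  have [r1 [e1 rs1 f1]] := IH _ rs b1; have [ev co] := eval_shift rs be.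
  by exists r1; split=> //; rewrite -co; apply: ExecIfTrue => //; rewrite ev.
- move=> e c1 c2 s s' t h _ IH r rs; rewrite !geq_max => /and3P[be b1 b2].
  have [r1 [e1 rs1 f1]] := IH _ rs b2; have [ev co] := eval_shift rs be.
  by exists r1; split=> //; rewrite -co; apply: ExecIfFalse => //; rewrite ev.
- move=> e c s s1 s2 t1 t2 h _ IH1 _ IH2 r rs b.
  have := b; rewrite geq_max => /andP[be bc].
  have [r1 [e1 rs1 f1]] := IH1 _ rs bc; have [r2 [e2 rs2 f2]] := IH2 _ rs1 b.
  have [ev co] := eval_shift rs be.
  exists r2; split=> //; last by move=> x x4; rewrite f2 // f1.
  by rewrite -co; apply: ExecWhileTrue e1 e2; rewrite ev.
- move=> e c s h r rs; rewrite geq_max => /andP[be bc].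
  have [ev co] := eval_shift rs be.
  by exists r; split=> //; rewrite -co; apply: ExecWhileFalse; rewrite ev.
Qed.

End Shift.

Fixpoint reset (m : nat) : cmd :=
  if m is j.+1 then Seq (reset j) (Assign j.+4 ELeaf) else Skip.

Lemma exec_reset m s : exists s',
  [/\ exec (reset m) s s' m.+1, shifted m s' (fun=> Leaf) & forall x, x < 4 -> s' x = s x].
Proof.
elim: m => [|m [s' [h sh f]]]; first by exists s; split=> //; apply: ExecSkip.
exists (upd s' m.+4 Leaf); split.
- by apply: exec_eq (ExecSeq h (ExecAssign s' m.+4 ELeaf)) _; rewrite /= addn1.
- move=> x; rewrite ltnS leq_eqVlt /upd !eqSS; case: eqP => //= _; exact: sh.
- by case=> [|[|[|[|x]]]] //= _; rewrite -f.
Qed.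

(* Variables 0 to 3 belong to the caller; the callee works on the others, which
   are cleared first since programs expect to start from leaves. *)
Definition call (c : cmd) (x y : nat) : cmd :=
  Seq (reset (cmd_bound c).+1)
    (Seq (Assign 4 (EVar x)) (Seq (shift_cmd c) (Assign y (EVar 4)))).

Definition overhead (c : cmd) : nat := (cmd_bound c).+2.

(** The factor 2 pays for copying the argument and the result: by [exec_tsize] the result is no
    larger than the argument plus the running time. *)
Lemma exec_call c x y s out b : x < 4 -> y < 4 -> computes_within c (s x) out b ->
  exists s' t, [/\ exec (call c x y) s s' t, s' y = out,
    forall z, z < 4 -> z != y -> s' z = s z & t <= overhead c + 2 * (b + tsize (s x))].
Proof.
move=> x4 y4 [s1 [t1 [h1 <- le1]]].
(* The successor keeps variable 4, through which argument and result pass, in the tracked range even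
   if [c] mentions no variable. *)
have [r [hr shr fr]] := exec_reset (cmd_bound c).+1 s.
pose r' := upd r 4 (r x).
have shr' : shifted (cmd_bound c).+1 r' (upd (fun=> Leaf) 0 (s x)).
  by move=> [|z] zm; [apply: fr|apply: (shr z.+1)].
have [r2 [h2 sh2 f2]] := exec_shift h1 shr' (leqnSn _).
exists (upd r2 y (r2 4)); eexists; split.
- apply: ExecSeq hr _; apply: ExecSeq; first exact: (ExecAssign r 4 (EVar x)).
  by apply: ExecSeq h2 _; apply: (ExecAssign r2 y (EVar 4)).
- by rewrite /upd eqxx; apply: sh2.
- move=> z z4 zy; rewrite /upd (negPf zy) f2 // -fr // /r' /upd.
  by case: eqP z4 => // ->.
- rewrite /= fr // (sh2 0) //.
  have := exec_tsize 0 h1; rewrite /upd /= /overhead; lia.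
Qed.

(* The bounds are powers of [n.+2], because every constant is then below some
   power and a sum of two powers below a third. *)
Definition polybd (I : Type) (P : I -> Prop) (n h : I -> nat) : Prop :=
  exists k, forall i, P i -> h i <= (n i).+2 ^ k.

Lemma leq_pow2 n m k l : n <= m -> k <= l -> n.+2 ^ k <= m.+2 ^ l.
Proof.
move=> nm kl; apply: leq_trans (_ : n.+2 ^ l <= _); first by rewrite leq_pexp2l.
by case: l {kl} => // l; rewrite leq_exp2r.
Qed.

(** * Arithmetic of polynomial bounds *)

Section Polybd.
Variables (I : Type) (P : I -> Prop) (n : I -> nat).
Implicit Types h : I -> nat.

Lemma polybd_le h h' : (forall i, P i -> h i <= h' i) -> polybd P n h' -> polybd P n h.
Proof. by move=> le [k hk]; exists k => i Pi; apply: leq_trans (le _ Pi) (hk _ Pi). Qed.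

Lemma polybd_const c : polybd P n (fun=> c).
Proof. by exists c => i _; apply: ltnW; apply: ltn_expl. Qed.

Lemma polybd_self : polybd P n n.
Proof. by exists 1 => i _; rewrite expn1; lia. Qed.

Lemma polybd_add h h' : polybd P n h -> polybd P n h' -> polybd P n (fun i => h i + h' i).
Proof.
move=> [k hk] [k' hk']; exists (maxn k k').+1 => i Pi.
have := leq_trans (hk _ Pi) (leq_pow2 (leqnn (n i)) (leq_maxl k k')).
have := leq_trans (hk' _ Pi) (leq_pow2 (leqnn (n i)) (leq_maxr k k')).
by rewrite expnS; nia.
Qed.

Lemma polybd_mul h h' : polybd P n h -> polybd P n h' -> polybd P n (fun i => h i * h' i).
Proof.
move=> [k hk] [k' hk']; exists (k + k') => i Pi.
by rewrite expnD leq_mul ?hk ?hk'.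
Qed.

Lemma polybd_exp h k : polybd P n h -> polybd P n (fun i => h i ^ k).
Proof.
move=> hh; elim: k => [|k IH]; first exact: polybd_const.
by apply: polybd_le (polybd_mul hh IH) => i _; rewrite expnS.
Qed.

Lemma polybd_trans h h' : polybd P n h -> polybd P h h' -> polybd P n h'.
Proof.
move=> hh [k hk]; apply: polybd_le hk _; apply: polybd_exp.
by apply: polybd_le (polybd_add hh (polybd_const 2)) => i _; rewrite addn2.
Qed.

Lemma polybd_horner (q : {poly nat}) : polybd P n (fun i => q.[n i])%R.
Proof.
elim/poly_ind: q => [|q c IH].
  by apply: polybd_le (polybd_const 0) => i _; rewrite horner0.
apply: polybd_le (polybd_add (polybd_mul IH polybd_self) (polybd_const c)) => i _.
by rewrite hornerMXaddC.
Qed.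

Lemma polybd_call c h h' : polybd P n h -> polybd P n h' ->
  polybd P n (fun i => overhead c + 2 * (h' i + h i)).
Proof.
move=> hh hh'; apply: polybd_add; first exact: polybd_const.
by apply: polybd_mul; [exact: polybd_const | exact: polybd_add].
Qed.

End Polybd.

Lemma horner_mono (q : {poly nat}) m n : m <= n -> (q.[m] <= q.[n])%N%R.
Proof.
move=> mn; elim/poly_ind: q => [|q c IH]; first by rewrite !horner0.
by rewrite !hornerMXaddC leq_add // leq_mul.
Qed.

Lemma computes_within_le c x y b b' :
  b <= b' -> computes_within c x y b -> computes_within c x y b'.
Proof. by move=> bb [s [t [h h0 le]]]; exists s, t; split=> //; apply: leq_trans bb. Qed.

(** One program and one exponent serve all indices satisfying [P]. The index carries the objects and
    the promise, while the program sees only the tree [f i]. *)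
Definition ptime (I : Type) (P : I -> Prop) (f g : I -> tree) : Prop :=
  exists c k, forall i, P i -> computes_within c (f i) (g i) ((tsize (f i)).+2 ^ k).

(** * Closure properties of polynomial time families *)

Section Ptime.
Variables (I : Type) (P : I -> Prop).
Implicit Types f g h : I -> tree.
Local Notation bounded f := (polybd P (fun i => tsize (f i))).

Lemma ptime_intro c f g b : bounded f b ->
  (forall i, P i -> computes_within c (f i) (g i) (b i)) -> ptime P f g.
Proof.
move=> [k hk] h; exists c, k => i Pi.
exact: computes_within_le (hk _ Pi) (h _ Pi).
Qed.

(** An output cannot exceed the input by more than the running time; this is what lets time bounds
    compose. *)
Lemma ptime_size f g : ptime P f g -> bounded f (fun i => tsize (g i)).
Proof.
move=> [c [k hc]].
apply: (@polybd_le _ _ _ _ (fun i => tsize (f i) + (tsize (f i)).+2 ^ k)); last first.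
  by apply: polybd_add; [apply: polybd_self | exists k].
move=> i /hc [s [t [/(exec_tsize 0) + <- le]]].
by rewrite /upd /=; lia.
Qed.

Lemma ptime_expr e f : ptime P f (fun i => eval (upd (fun=> Leaf) 0 (f i)) e).
Proof.
pose st i := upd (fun=> Leaf) 0 (f i).
apply: (@ptime_intro (Assign 0 e) _ _ (fun i => cost (st i) e)).
  elim: e => [x||a IHa b IHb|a IHa|a IHa|a IHa b IHb] /=.
  - apply: (@polybd_le _ _ _ _ (fun i => tsize (f i))); last exact: polybd_self.
    by move=> i _; rewrite addn0 /st /upd; case: eqP => //= _; apply: tsize_gt0.
  - exact: polybd_const.
  - apply: polybd_le (polybd_add (polybd_const _ _ 1)
      (polybd_add (polybd_add IHa IHb) (polybd_add IHa IHb))) => i _ /=.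
    by have := tsize_eval (st i) a; have := tsize_eval (st i) b; lia.
  - apply: polybd_le (polybd_add (polybd_const _ _ 1) (polybd_add IHa IHa)) => i _ /=.
    by have := tsize_eval (st i) a; case: (eval _ a) => /= *; lia.
  - apply: polybd_le (polybd_add (polybd_const _ _ 1) (polybd_add IHa IHa)) => i _ /=.
    by have := tsize_eval (st i) a; case: (eval _ a) => /= *; lia.
  - apply: polybd_le (polybd_add (polybd_const _ _ 3) (polybd_add IHa IHb)) => i _ /=.
    by case: (_ == _) => /=; lia.
move=> i _; exists (upd (st i) 0 (eval (st i) e)), (cost (st i) e).
by split=> //; apply: ExecAssign.
Qed.

Lemma ptime_ext f g g' : (forall i, P i -> g i = g' i) -> ptime P f g -> ptime P f g'.
Proof. by move=> e [c [k h]]; exists c, k => i Pi; rewrite -e //; apply: h. Qed.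

Lemma ptime_id f : ptime P f f.
Proof. exact: (ptime_expr (EVar 0)). Qed.

Lemma ptime_trans f g h : ptime P f g -> ptime P g h -> ptime P f h.
Proof.
move=> fg; have sg := ptime_size fg; case: fg => c [k hc] [c' [k' hc']].
apply: (@ptime_intro (Seq (call c 0 0) (call c' 0 0)) _ _ (fun i =>
  (overhead c + 2 * ((tsize (f i)).+2 ^ k + tsize (f i))) +
  (overhead c' + 2 * ((tsize (g i)).+2 ^ k' + tsize (g i))))).
  apply: polybd_add; apply: polybd_call => //; first exact: polybd_self.
    by exists k.
  by apply: polybd_trans sg _; exists k'.
move=> i Pi.
pose s0 := upd (fun=> Leaf) 0 (f i).
have [//|//|s1 [t1 [e1 v1 _ le1]]] := @exec_call c 0 0 s0 _ _ _ _ (hc _ Pi).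
have := hc' _ Pi; rewrite -{1}v1 => hc'i.
have [//|//|s2 [t2 [e2 v2 _ le2]]] := @exec_call c' 0 0 s1 _ _ _ _ hc'i.
exists s2, (t1 + t2); split=> //; first exact: ExecSeq e1 e2.
by apply: leq_add => //; rewrite v1 in le2.
Qed.

(** The argument is left in variable 0 so that both calls can read it; variables 1 and 2 receive the
    results. *)
Lemma ptime_node f g h : ptime P f g -> ptime P f h -> ptime P f (fun i => Node (g i) (h i)).
Proof.
move=> fg fh; have sg := ptime_size fg; have sh := ptime_size fh.
case: fg fh => c [k hc] [c' [k' hc']].
apply: (@ptime_intro (Seq (call c 0 1) (Seq (call c' 0 2)
  (Assign 0 (ENode (EVar 1) (EVar 2))))) _ _ (fun i =>
  (overhead c + 2 * ((tsize (f i)).+2 ^ k + tsize (f i))) +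
  (overhead c' + 2 * ((tsize (f i)).+2 ^ k' + tsize (f i))) +
  (1 + 2 * (tsize (g i) + tsize (h i))))).
  apply: polybd_add.
    apply: polybd_add; apply: polybd_call => //; try exact: polybd_self.
      by exists k.
    by exists k'.
  apply: polybd_add; first exact: polybd_const.
  by apply: polybd_mul; [exact: polybd_const | exact: polybd_add].
move=> i Pi.
pose s0 := upd (fun=> Leaf) 0 (f i).
have [//|//|s1 [t1 [e1 v1 f1 le1]]] := @exec_call c 0 1 s0 _ _ _ _ (hc _ Pi).
have := hc' _ Pi; rewrite -[X in computes_within _ X]/(s0 0) -f1 // => hc'i.
have [//|//|s2 [t2 [e2 v2 f2 le2]]] := @exec_call c' 0 2 s1 _ _ _ _ hc'i.
eexists; eexists; split.
- by apply: ExecSeq e1 (ExecSeq e2 _); apply: ExecAssign.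
- by rewrite /upd /= v2 f2 // v1.
- by rewrite /= v2 (f2 1) // v1; rewrite f1 // in le2; rewrite /s0 /upd /= in le1 le2; lia.
Qed.

End Ptime.

(** A branch is run only when selected, so its promise may include the outcome of the test. *)
Lemma ptime_if (I : Type) (P : I -> Prop) (f g h : I -> tree) (b : I -> bool) :
  ptime P f (fun i => enc_bool (b i)) ->
  ptime (fun i => P i /\ b i) f g -> ptime (fun i => P i /\ ~~ b i) f h ->
  ptime P f (fun i => if b i then g i else h i).
Proof.
move=> [c [k hc]] [c1 [k1 hc1]] [c2 [k2 hc2]].
apply: (@ptime_intro _ _ (Seq (call c 0 1) (If (EVar 1) (call c1 0 0) (call c2 0 0))) _ _ (fun i =>
  (overhead c + 2 * ((tsize (f i)).+2 ^ k + tsize (f i))) + (3 +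
  (overhead c1 + 2 * ((tsize (f i)).+2 ^ k1 + tsize (f i))) +
  (overhead c2 + 2 * ((tsize (f i)).+2 ^ k2 + tsize (f i)))))).
  apply: polybd_add; last (apply: polybd_add; first apply: polybd_add).
  - by apply: polybd_call; [exact: polybd_self|exists k].
  - exact: polybd_const.
  - by apply: polybd_call; [exact: polybd_self|exists k1].
  - by apply: polybd_call; [exact: polybd_self|exists k2].
move=> i Pi.
pose s0 := upd (fun=> Leaf) 0 (f i).
have [//|//|s1 [t1 [e1 v1 f1 le1]]] := @exec_call c 0 1 s0 _ _ _ _ (hc _ Pi).
case: ifP => bi.
  have := hc1 _ (conj Pi bi); rewrite -[X in computes_within _ X]/(s0 0) -f1 // => hi.
  have [//|//|s2 [t2 [e2 v2 f2 le2]]] := @exec_call c1 0 0 s1 _ _ _ _ hi.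
  eexists; eexists; split; [|exact: v2|].
    by apply: ExecSeq e1 (ExecIfTrue _ _ e2); rewrite /= v1 bi Node_neq_Leaf.
  by rewrite /= v1 bi /=; rewrite f1 // in le2; rewrite /s0 /upd /= in le1 le2; lia.
have := hc2 _ (conj Pi (negbT bi)); rewrite -[X in computes_within _ X]/(s0 0) -f1 // => hi.
have [//|//|s2 [t2 [e2 v2 f2 le2]]] := @exec_call c2 0 0 s1 _ _ _ _ hi.
eexists; eexists; split; [|exact: v2|].
  by apply: ExecSeq e1 (ExecIfFalse _ _ e2); rewrite /= v1 bi.
by rewrite /= v1 bi /=; rewrite f1 // in le2; rewrite /s0 /upd /= in le1 le2; lia.
Qed.

Lemma ptime_reindex (I J : Type) (P : I -> Prop) (Q : J -> Prop) (phi : J -> I) (f g : I -> tree) :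
  (forall j, Q j -> P (phi j)) -> ptime P f g ->
  ptime Q (fun j => f (phi j)) (fun j => g (phi j)).
Proof. by move=> QP [c [k h]]; exists c, k => j /QP; apply: h. Qed.

(* In step [x] of a fold over the list [l x.1], [x.2.1] is the part already
   processed and [x.2.2] the current element; [acc i l1] is the value of the
   accumulator after the prefix [l1]. *)
Section Fold.
Variables (I A : Type) (P : I -> Prop) (enc : A -> tree) (l : I -> seq A).
Variables (f : I -> tree) (acc : I -> seq A -> tree).

Definition fold_dom (x : I * (seq A * A)) : Prop :=
  P x.1 /\ exists l2, l x.1 = x.2.1 ++ x.2.2 :: l2.

Definition fold_ctx (x : I * (seq A * A)) : tree :=
  Node (f x.1) (Node (enc x.2.2) (acc x.1 x.2.1)).

(** The bound is in the original input, uniformly over all prefixes: a polynomial bound on each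
    single step would not prevent exponential growth. *)
Definition fold_acc_bounded : Prop := exists k, forall i l1 l2,
  P i -> l i = l1 ++ l2 -> tsize (acc i l1) <= (tsize (f i)).+2 ^ k.

Lemma tsize_enc_cat l1 l2 : tsize (enc_seq enc l2) <= tsize (enc_seq enc (l1 ++ l2)).
Proof. by elim: l1 => //= a l1 IH; lia. Qed.

Lemma size_enc_seq l1 : size l1 <= tsize (enc_seq enc l1).
Proof. by elim: l1 => //= a l1 IH; lia. Qed.

(** Variable 0 holds the argument of the fold, 1 the remaining list, 2 the accumulator and 3 the
    context handed to [c]. *)
Definition fold_body (c : cmd) : cmd :=
  Seq (Assign 3 (ENode (EVar 0) (ENode (ELeft (EVar 1)) (EVar 2))))
    (Seq (call c 3 2) (Assign 1 (ERight (EVar 1)))).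

(** Here [n] bounds the trees handled and [b] a run of [c] on one context; [9 * n] pays for the loop
    test and the assignments of one round, the first [n] for the final test. *)
Lemma exec_fold c i b n : P i ->
  (forall l1 a l2, l i = l1 ++ a :: l2 -> tsize (fold_ctx (i, (l1, a))) <= n /\
     computes_within c (fold_ctx (i, (l1, a))) (acc i (rcons l1 a)) b) ->
  tsize (enc_seq enc (l i)) <= n ->
  forall l2 l1 s, l i = l1 ++ l2 -> s 0 = f i -> s 1 = enc_seq enc l2 -> s 2 = acc i l1 ->
  exists s' t, [/\ exec (While (EVar 1) (fold_body c)) s s' t, s' 2 = acc i (l i) &
    t <= n + size l2 * (overhead c + 2 * (b + n) + 9 * n)].
Proof.
move=> Pi step len; elim=> [|a l2 IH] l1 s eql s0 s1 s2.
  exists s, (cost s (EVar 1)); split; first by apply: ExecWhileFalse; rewrite /= s1.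
    by rewrite s2 eql cats0.
  by rewrite /= s1 /= mul0n; have := tsize_gt0 (enc_seq enc (l i)); lia.
have [ctxn hc] := step _ _ _ eql.
have ln : tsize (enc_seq enc (a :: l2)) <= n.
  by apply: leq_trans len; rewrite eql; apply: tsize_enc_cat.
pose s3 := upd s 3 (fold_ctx (i, (l1, a))).
have [//|//|s4 [t4 [e4 v4 f4 le4]]] := @exec_call c 3 2 s3 _ _ _ _ hc.
pose s5 := upd s4 1 (enc_seq enc l2).
have [||||s' [t [e v le]]] := IH (rcons l1 a) s5; try by [].
- by rewrite eql cat_rcons.
- by rewrite /s5 /upd /= f4.
exists s'; eexists; split; [|exact: v|].
- apply: ExecWhileTrue e; first by rewrite /= s1 Node_neq_Leaf.
  apply: ExecSeq; last apply: ExecSeq e4 _.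
    have -> : s3 = upd s 3 (eval s (ENode (EVar 0) (ENode (ELeft (EVar 1)) (EVar 2)))).
      by rewrite /= s0 s1 s2.
    exact: ExecAssign.
  have -> : s5 = upd s4 1 (eval s4 (ERight (EVar 1))).
    by rewrite /= f4 // /s3 /upd /= s1.
  exact: ExecAssign.
- rewrite /= s0 s1 s2 f4 // /s3 /upd /= s1 /=.
  move: ctxn ln le le4; rewrite /s3 /upd /= mulSn; set X := _ * _; set Y := overhead c.
  by lia.
Qed.

Lemma ptime_fold :
  ptime P f (fun i => enc_seq enc (l i)) -> ptime P f (fun i => acc i [::]) ->
  fold_acc_bounded ->
  ptime fold_dom fold_ctx (fun x => acc x.1 (rcons x.2.1 x.2.2)) ->
  ptime P f (fun i => acc i (l i)).
Proof.
move=> hl h0 [k0 hacc]; have sl := ptime_size hl; have sz0 := ptime_size h0.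
case: hl h0 => cl [kl hl] [ci [ki hi]] [c [k hc]].
(* The bounds for argument, list and accumulator add up to one for [fold_ctx], whose two pairing
   nodes give the 2. *)
pose n i := tsize (f i) + tsize (enc_seq enc (l i)) + (tsize (f i)).+2 ^ k0 + 2.
pose b i := (n i).+2 ^ k.
have bn : polybd P (fun i => tsize (f i)) n.
  apply: polybd_add; last exact: polybd_const.
  by apply: polybd_add; [apply: polybd_add => //; exact: polybd_self | exists k0].
have bb : polybd P (fun i => tsize (f i)) b by apply: polybd_trans bn _; exists k.
apply: (@ptime_intro _ _ (Seq (call cl 0 1) (Seq (call ci 0 2)
  (Seq (While (EVar 1) (fold_body c)) (Assign 0 (EVar 2))))) _ _ (fun i =>
  (overhead cl + 2 * ((tsize (f i)).+2 ^ kl + tsize (f i))) +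
  (overhead ci + 2 * ((tsize (f i)).+2 ^ ki + tsize (f i))) +
  (n i + tsize (enc_seq enc (l i)) * (overhead c + 2 * (b i + n i) + 9 * n i) +
   (tsize (f i)).+2 ^ k0))).
  apply: polybd_add.
    apply: polybd_add; apply: polybd_call => //; try exact: polybd_self.
      by exists kl.
    by exists ki.
  apply: polybd_add; last by exists k0.
  apply: polybd_add => //; apply: polybd_mul => //.
  apply: polybd_add; first exact: polybd_call.
  by apply: polybd_mul => //; exact: polybd_const.
move=> i Pi.
pose s0 := upd (fun=> Leaf) 0 (f i).
have [//|//|s1 [t1 [e1 v1 f1 le1]]] := @exec_call cl 0 1 s0 _ _ _ _ (hl _ Pi).
have := hi _ Pi; rewrite -[X in computes_within _ X]/(s0 0) -f1 // => hii.
have [//|//|s2 [t2 [e2 v2 f2 le2]]] := @exec_call ci 0 2 s1 _ _ _ _ hii.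
have step l1 a l2 : l i = l1 ++ a :: l2 -> tsize (fold_ctx (i, (l1, a))) <= n i /\
    computes_within c (fold_ctx (i, (l1, a))) (acc i (rcons l1 a)) (b i).
  move=> eql.
  have le : tsize (fold_ctx (i, (l1, a))) <= n i.
    have := hacc _ _ _ Pi eql; have := tsize_enc_cat l1 (a :: l2).
    by rewrite -eql /n /fold_ctx /=; lia.
  split=> //; have := hc (i, (l1, a)) (conj Pi (ex_intro _ l2 eql)).
  by apply: computes_within_le; apply: leq_pow2.
have [|||||s3 [t3 [e3 v3 le3]]] := exec_fold Pi step _ (l2 := l i) (l1 := [::]) (s := s2);
  try by [].
- by rewrite /n; lia.
- by rewrite f2 // f1.
- by rewrite f2 // v1.
eexists; eexists; split.
- by apply: ExecSeq e1 (ExecSeq e2 (ExecSeq e3 _)); apply: ExecAssign.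
- by rewrite /upd /= v3.
- rewrite /= v3.
  have := hacc i (l i) [::] Pi; rewrite cats0 => /(_ erefl) le4.
  have le5 := leq_mul (size_enc_seq (l i))
    (leqnn (overhead c + 2 * (b i + n i) + 9 * n i)).
  move: le1 le2 le3 le4 le5; rewrite f1 // /s0 /upd /=.
  set X := size _ * _; set Y := tsize (enc_seq _ _) * _.
  set a1 := _ ^ _; set a2 := _ ^ _; set a3 := _ ^ _.
  by lia.
Qed.

End Fold.

(** * Constants, equality tests and Boolean connectives *)

Fixpoint quote (t : tree) : expr :=
  if t is Node a b then ENode (quote a) (quote b) else ELeaf.

Lemma eval_quote s t : eval s (quote t) = t.
Proof. by elim: t => //= a -> b ->. Qed.

Lemma ptime_const (I : Type) (P : I -> Prop) (f : I -> tree) t : ptime P f (fun=> t).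
Proof. by apply: ptime_ext (ptime_expr P (quote t) f) => i _; apply: eval_quote. Qed.

Section Basic.
Variables (I : Type) (P : I -> Prop) (f : I -> tree).
Implicit Types (g h : I -> tree) (a b : I -> bool).

Lemma ptime_left g h : ptime P f (fun i => Node (g i) (h i)) -> ptime P f g.
Proof. by move=> gh; apply: ptime_trans gh (ptime_expr _ (ELeft (EVar 0)) _). Qed.

Lemma ptime_right g h : ptime P f (fun i => Node (g i) (h i)) -> ptime P f h.
Proof. by move=> gh; apply: ptime_trans gh (ptime_expr _ (ERight (EVar 0)) _). Qed.

Lemma ptime_eq (A : eqType) (enc : A -> tree) (x y : I -> A) : injective enc ->
  ptime P f (fun i => enc (x i)) -> ptime P f (fun i => enc (y i)) ->
  ptime P f (fun i => enc_bool (x i == y i)).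
Proof.
move=> inj fx fy; apply: ptime_trans (ptime_node fx fy) _.
apply: ptime_ext (ptime_expr _ (EEq (ELeft (EVar 0)) (ERight (EVar 0))) _) => i _ /=.
by rewrite (inj_eq inj).
Qed.

Lemma ptime_not a : ptime P f (fun i => enc_bool (a i)) ->
  ptime P f (fun i => enc_bool (~~ a i)).
Proof.
move=> fa; apply: ptime_ext (ptime_if fa (ptime_const _ _ (enc_bool false))
  (ptime_const _ _ (enc_bool true))) => i _ /=.
by case: (a i).
Qed.

Lemma ptime_and a b : ptime P f (fun i => enc_bool (a i)) ->
  ptime P f (fun i => enc_bool (b i)) -> ptime P f (fun i => enc_bool (a i && b i)).
Proof.
move=> fa fb.
apply: ptime_ext (ptime_if (g := fun i => enc_bool (b i)) (h := fun=> enc_bool false) fa _ _).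
- by move=> i _; case: (a i).
- by apply: (ptime_reindex (phi := id)) fb => i [].
- exact: ptime_const.
Qed.

Lemma ptime_or a b : ptime P f (fun i => enc_bool (a i)) ->
  ptime P f (fun i => enc_bool (b i)) -> ptime P f (fun i => enc_bool (a i || b i)).
Proof.
move=> fa fb.
apply: ptime_ext (ptime_not (ptime_and (ptime_not fa) (ptime_not fb))) => i _.
by rewrite negb_and !negbK.
Qed.

End Basic.

Lemma ptime_choose (I : Type) (P : I -> Prop) (f g h : I -> tree) (b : I -> bool) :
  ptime P f (fun i => enc_bool (b i)) -> ptime P f g -> ptime P f h ->
  ptime P f (fun i => if b i then g i else h i).
Proof.
move=> fb fg fh; apply: ptime_if => //.
  by apply: (ptime_reindex (phi := id)) fg => i [].
by apply: (ptime_reindex (phi := id)) fh => i [].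
Qed.

Section FoldContext.
Variables (I A : Type) (P : I -> Prop) (enc : A -> tree) (l : I -> seq A).
Variables (f : I -> tree) (acc : I -> seq A -> tree).
Local Notation Q := (fold_dom P l).
Local Notation ctx := (fold_ctx enc f acc).

(** The context contains the argument of the fold, so whatever is computable from that argument
    stays available in the body. *)
Lemma ctx_lift g : ptime P f g -> ptime Q ctx (fun x => g x.1).
Proof.
move=> fg; apply: ptime_trans (ptime_left (ptime_id _ _)) _.
by apply: ptime_reindex fg => x [].
Qed.

Lemma ctx_elt : ptime Q ctx (fun x => enc x.2.2).
Proof. exact: ptime_left (ptime_right (ptime_id _ _)). Qed.

Lemma ctx_acc : ptime Q ctx (fun x => acc x.1 x.2.1).
Proof. exact: ptime_right (ptime_right (ptime_id _ _)). Qed.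

End FoldContext.

(** * Operations on lists *)

Section EncSeq.
Variables (A : Type) (enc : A -> tree).
Implicit Types l : seq A.

Lemma tsize_enc_seq l : tsize (enc_seq enc l) = (\sum_(a <- l) (tsize (enc a)).+1).+1.
Proof. by elim: l => [|a l IH] /=; rewrite ?big_nil ?big_cons // IH; lia. Qed.

Lemma tsize_enc_filter p l : tsize (enc_seq enc (filter p l)) <= tsize (enc_seq enc l).
Proof. by elim: l => //= a l IH; case: (p a) => /=; lia. Qed.

Lemma tsize_enc_catr l1 l2 : tsize (enc_seq enc l1) <= tsize (enc_seq enc (l1 ++ l2)).
Proof. by rewrite !tsize_enc_seq big_cat /= ltnS leq_addr. Qed.

Lemma enc_seq_inj : injective enc -> injective (enc_seq enc).
Proof. by move=> inj; elim=> [|a l IH] [|b l'] //= [/inj-> /IH->]. Qed.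

End EncSeq.

Lemma tsize_enc_rev (A : eqType) (enc : A -> tree) (l : seq A) :
  tsize (enc_seq enc (rev l)) = tsize (enc_seq enc l).
Proof. by rewrite !tsize_enc_seq; congr _.+1; apply: perm_big; rewrite perm_rev. Qed.

(** Elements of [s] are deleted from [l] one at a time. This bounds the stages by [W] and the
    conclusions, however many steps are made. *)
Lemma tsize_enc_subset (A : eqType) (enc : A -> tree) (s l : seq A) :
  uniq s -> {subset s <= l} -> tsize (enc_seq enc s) <= tsize (enc_seq enc l).
Proof.
rewrite !tsize_enc_seq ltnS; elim: s l => [|x s IH] l; first by rewrite big_nil.
move=> /= /andP[xs us] sub; have xl := sub x (mem_head _ _).
rewrite (perm_big _ (perm_to_rem xl)) !big_cons leq_add2l; apply: IH => // y ys.
have := sub y; rewrite inE ys orbT => /(_ isT).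
rewrite (perm_mem (perm_to_rem xl)) inE => /orP[/eqP e|//].
by rewrite -e ys in xs.
Qed.

Section Lists.
Variables (I : Type) (A : eqType) (P : I -> Prop) (enc : A -> tree) (l : I -> seq A).
Variable f : I -> tree.
Hypothesis f_l : ptime P f (fun i => enc_seq enc (l i)).

Lemma fold_acc_bounded_by acc h :
  polybd P (fun i => tsize (f i)) h ->
  (forall i l1 l2, P i -> l i = l1 ++ l2 -> tsize (acc i l1) <= h i) ->
  fold_acc_bounded P l f acc.
Proof.
by move=> [k hk] le; exists k => i l1 l2 Pi e; apply: leq_trans (le _ _ _ Pi e) (hk _ Pi).
Qed.

(** Membership is part of the promise because queries about a default are known to be admissible
    only for members of the list. *)
Definition elt_dom (x : I * A) : Prop := P x.1 /\ x.2 \in l x.1.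
Definition elt_ctx (x : I * A) : tree := Node (f x.1) (enc x.2).

Lemma elt_lift g : ptime P f g -> ptime elt_dom elt_ctx (fun x => g x.1).
Proof.
move=> fg; apply: ptime_trans (ptime_left (ptime_id _ _)) _.
by apply: ptime_reindex fg => x [].
Qed.

Lemma elt_elt : ptime elt_dom elt_ctx (fun x => enc x.2).
Proof. exact: ptime_right (ptime_id _ _). Qed.

Lemma ptime_fold_elt acc g : ptime elt_dom elt_ctx g ->
  ptime (fold_dom P l) (fold_ctx enc f acc) (fun x => g (x.1, x.2.2)).
Proof.
move=> hg; apply: (@ptime_trans _ _ _ (fun x => elt_ctx (x.1, x.2.2))).
  by apply: ptime_node (ctx_elt _ _ _ _ _); apply: ctx_lift; apply: ptime_id.
apply: (ptime_reindex (phi := fun x => (x.1, x.2.2))) hg => -[i [l1 a]] /= [Pi [l2 e]].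
by split=> //=; rewrite e mem_cat mem_head orbT.
Qed.

Lemma ptime_has (p : I -> pred A) :
  ptime elt_dom elt_ctx (fun x => enc_bool (p x.1 x.2)) ->
  ptime P f (fun i => enc_bool (has (p i) (l i))).
Proof.
move=> hp; apply: (ptime_fold (acc := fun i l1 => enc_bool (has (p i) l1)) f_l).
- exact: ptime_const.
- apply: (fold_acc_bounded_by (polybd_const _ _ 3)) => i l1 l2 _ _.
  by case: (has _ _).
- apply: ptime_ext (ptime_or (ptime_fold_elt _ hp)
    (ctx_acc P enc l f (fun i l1 => enc_bool (has (p i) l1)))) => x _ /=.
  by rewrite has_rcons.
Qed.

Lemma ptime_mem (x : I -> A) : injective enc -> ptime P f (fun i => enc (x i)) ->
  ptime P f (fun i => enc_bool (x i \in l i)).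
Proof.
move=> inj fx; apply: ptime_ext (ptime_has (p := fun i => pred1 (x i)) _).
  by move=> i _; rewrite has_pred1.
by apply: ptime_eq inj _ (elt_lift fx); apply: elt_elt.
Qed.

Lemma ptime_rev : ptime P f (fun i => enc_seq enc (rev (l i))).
Proof.
apply: (ptime_fold (acc := fun i l1 => enc_seq enc (rev l1)) f_l).
- exact: ptime_const.
- apply: (fold_acc_bounded_by (ptime_size f_l)) => i l1 l2 _ ->.
  by rewrite tsize_enc_rev tsize_enc_catr.
- apply: ptime_ext (ptime_node (ctx_elt P enc l f (fun i l1 => enc_seq enc (rev l1)))
    (ctx_acc _ _ _ _ _)) => x _ /=.
  by rewrite rev_rcons.
Qed.

End Lists.

Lemma ptime_filter (I : Type) (A : eqType) (P : I -> Prop) (enc : A -> tree)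
    (l : I -> seq A) (f : I -> tree) (p : I -> pred A) :
  ptime P f (fun i => enc_seq enc (l i)) ->
  ptime (elt_dom P l) (elt_ctx enc f) (fun x => enc_bool (p x.1 x.2)) ->
  ptime P f (fun i => enc_seq enc (filter (p i) (l i))).
Proof.
move=> f_l hp.
(* Consing onto the accumulator reverses the order, so the filtered list is built in reverse and
   turned round at the end. *)
suff h : ptime P f (fun i => enc_seq enc (rev (filter (p i) (l i)))).
  by apply: ptime_ext (ptime_rev h) => i _; rewrite revK.
pose acc i l1 := enc_seq enc (rev (filter (p i) l1)).
apply: (ptime_fold (acc := acc) f_l).
- exact: ptime_const.
- apply: (fold_acc_bounded_by (ptime_size f_l)) => i l1 l2 _ ->.
  rewrite tsize_enc_rev; apply: leq_trans (tsize_enc_filter _ _ _) _.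
  exact: tsize_enc_catr.
- apply: ptime_ext (ptime_choose (ptime_fold_elt _ hp)
    (ptime_node (ctx_elt _ _ _ _ _) (ctx_acc _ _ _ _ acc)) (ctx_acc _ _ _ _ acc)) => x _ /=.
  by rewrite /acc filter_rcons; case: (p _ _); rewrite ?rev_rcons.
Qed.

(** * Encodings of formulae, defaults and theories *)

Lemma enc_bool_inj : injective enc_bool.
Proof. by case; case. Qed.

Lemma enc_form_inj : injective enc_form.
Proof.
elim=> [w|||a IHa|a IHa b IHb|a IHa b IHb|a IHa b IHb] [w'|||a'|a' b'|a' b'|a' b'] //=.
- by move=> [/(enc_seq_inj enc_bool_inj) ->].
- by move=> [/IHa ->].
- by move=> [/IHa -> /IHb ->].
- by move=> [/IHa -> /IHb ->].
- by move=> [/IHa -> /IHb ->].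
Qed.

Lemma enc_default_inj : injective enc_default.
Proof.
case=> a b c [a' b' c'] [] /=.
by move=> /enc_form_inj-> /enc_form_inj-> /enc_form_inj->.
Qed.

Lemma flength_le_tsize phi : flength phi <= tsize (enc_form phi).
Proof.
elim: phi => [w|||a IHa|a IHa b IHb|a IHa b IHb|a IHa b IHb] //=; try lia.
by rewrite tsize_enc_seq; elim: w => [|x w IH]; rewrite ?big_nil ?big_cons //=; lia.
Qed.

Lemma forms_size_le_tsize S : forms_size S <= tsize (enc_forms S).
Proof.
rewrite /enc_forms tsize_enc_seq /forms_size; apply: leqW; apply: leq_sum => phi _.
exact: leqW (flength_le_tsize _).
Qed.

Lemma flength_gt0 phi : 0 < flength phi.
Proof. by case: phi. Qed.

(** The largest tag, that of [Imp], has 13 nodes; together with two pairing nodes it fits into 16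
    per connective. *)
Lemma tsize_enc_form phi : tsize (enc_form phi) <= 16 * flength phi.
Proof.
elim: phi => [w|||a IHa|a IHa b IHb|a IHa b IHb|a IHa b IHb] //=; try lia.
by rewrite tsize_enc_seq; elim: w => [|[] w IH]; rewrite ?big_nil ?big_cons //=; lia.
Qed.

Lemma tsize_enc_default d : tsize (enc_default d) <= 18 * default_size d.
Proof.
rewrite /default_size /=; have := flength_gt0 (prereq d).
have := tsize_enc_form (prereq d); have := tsize_enc_form (just d).
by have := tsize_enc_form (concl d); lia.
Qed.

Lemma default_size_gt0 d : 0 < default_size d.
Proof. by rewrite /default_size; have := flength_gt0 (prereq d); lia. Qed.

Lemma tsize_Node a b : tsize (Node a b) = (tsize a + tsize b).+1.
Proof. by []. Qed.

(** The 5 counts the ends of the three lists and the two nodes pairing them. *)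
Lemma tsize_enc_theory D W T :
  tsize (enc_theory D W T) <= 20 * (theory_size D W + order_size T) + 5.
Proof.
(* The strict inequality pays for the list cell of each element. *)
have sum (A : Type) (s : seq A) (F G : A -> nat) : (forall x, F x < 20 * G x) ->
    \sum_(x <- s) (F x).+1 <= 20 * \sum_(x <- s) G x.
  by move=> FG; rewrite big_distrr; apply: leq_sum.
rewrite /theory_size /order_size /forms_size !mulnDr.
have hd d : tsize (enc_default d) <= 18 * default_size d /\ 0 < default_size d.
  by split; [apply: tsize_enc_default | apply: default_size_gt0].
have hD := sum _ D (fun d => tsize (enc_default d)) default_size.
have {}hD := hD (fun d => ltac:(have := hd d; lia)).
have hW := sum _ W (fun phi => tsize (enc_form phi)) flength.
have {}hW := hW (fun d => ltac:(have := tsize_enc_form d; have := flength_gt0 d; lia)).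
have hT := sum _ T (fun x => tsize (enc_pair enc_default enc_default x))
  (fun x => default_size x.1 + default_size x.2).
have {}hT := hT (fun x => ltac:(have := hd x.1; have := hd x.2;
  rewrite /enc_pair tsize_Node; lia)).
by rewrite /enc_theory /enc_forms !tsize_Node !tsize_enc_seq; lia.
Qed.

Section Defaults.
Variables (I : Type) (P : I -> Prop) (f : I -> tree) (d : I -> default).
Hypothesis f_d : ptime P f (fun i => enc_default (d i)).

Lemma ptime_prereq : ptime P f (fun i => enc_form (prereq (d i))).
Proof. exact: ptime_left f_d. Qed.

Lemma ptime_notjust : ptime P f (fun i => enc_form (Not (just (d i)))).
Proof. exact: ptime_node (ptime_const _ _ _) (ptime_left (ptime_right f_d)). Qed.

Lemma ptime_concl : ptime P f (fun i => enc_form (concl (d i))).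
Proof. exact: ptime_right (ptime_right f_d). Qed.

End Defaults.

(** * The algorithm *)

(** A classical truth value with no program attached; [ptime_entails] computes it where the pair
    lies in [K]. *)
Definition entailsb (S : seq formula) (phi : formula) : bool := `[< entails [set` S] phi >].

Definition activeb (S : seq formula) (d : default) : bool :=
  [&& entailsb S (prereq d), ~~ entailsb S (Not (just d)) & ~~ entailsb S (concl d)].

(** The candidate enters its stages only through these tests, so this list is computed once and
    passed on in its place. *)
Definition unblocked (D : seq default) (F : seq formula) : seq default :=
  [seq d <- D | ~~ entailsb F (Not (just d))].

(** Repetitions are avoided because the entailment program expects lists without them. *)
Definition insert (phi : formula) (S : seq formula) : seq formula :=
  if phi \in S then S else phi :: S.

Section Algorithm.
Variables (D : seq default) (W : seq formula) (T : seq (default * default)).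

Definition firesb (B : seq default) (S : seq formula) (d : default) : bool :=
  [&& d \in B, entailsb S (prereq d) &
      ~~ has (fun x => (x.2 == d) && (x.1 \in filter (activeb S) D)) T].

(** Every test is made on the old stage [S]; only [S'] grows during the pass. *)
Definition collect (B : seq default) (S : seq formula) (l : seq default) : seq formula :=
  foldl (fun S' d => if firesb B S d then insert (concl d) S' else S') S l.

Definition stageb (B : seq default) (j : nat) : seq formula :=
  iter j (fun S => collect B S D) W.

(* When [E] is the preferred extension, the [k]-th approximation is equivalent to
   the [k]-th stage of [E]. *)
Fixpoint approx (k : nat) : seq formula :=
  if k is j.+1 then stageb (unblocked D (approx j)) k else W.

Lemma mem_insert phi S psi : (psi \in insert phi S) = (psi == phi) || (psi \in S).
Proof. by rewrite /insert; case: ifP => h; rewrite ?inE //; case: eqP => // ->. Qed.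

Lemma uniq_insert phi S : uniq S -> uniq (insert phi S).
Proof. by rewrite /insert; case: ifP => //= ->. Qed.

Lemma mem_collect B S l psi : reflect
  (psi \in S \/ exists2 d, d \in l & firesb B S d /\ concl d = psi) (psi \in collect B S l).
Proof.
rewrite /collect; elim/last_ind: l => [|l d IH].
  by apply: (iffP idP) => [|[|[]]] //; left.
rewrite foldl_rcons; case: ifP => fd; last first.
  apply: (iffP IH) => -[h|[d' h h']]; first by left.
  - by right; exists d' => //; rewrite mem_rcons inE h orbT.
  - by left.
  - move: h; rewrite mem_rcons inE => /orP[/eqP e|h]; last by right; exists d'.
    by case: h'; rewrite e fd.
rewrite mem_insert; apply: (iffP orP) => [[/eqP ->|/IH[h|[d' h h']]]|[h|[d' + [h' e]]]].
- by right; exists d => //; rewrite mem_rcons mem_head.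
- by left.
- by right; exists d' => //; rewrite mem_rcons inE h orbT.
- by right; apply/IH; left.
- rewrite mem_rcons inE => /orP[/eqP ed|h]; first by left; rewrite -e ed.
  by right; apply/IH; right; exists d'.
Qed.

Lemma uniq_collect B S l : uniq S -> uniq (collect B S l).
Proof.
move=> uS; rewrite /collect; elim/last_ind: l => [|l d IH] //.
by rewrite foldl_rcons; case: ifP => // _; apply: uniq_insert.
Qed.

Lemma tsize_collect B S l :
  tsize (enc_forms (collect B S l)) <= tsize (enc_forms S) + tsize (enc_seq enc_default l).
Proof.
rewrite /collect /enc_forms [X in _ + X]tsize_enc_seq; elim/last_ind: l => [|l d IH] /=.
  by rewrite leq_addr.
have -> : \sum_(a <- rcons l d) (tsize (enc_default a)).+1 =
    \sum_(a <- l) (tsize (enc_default a)).+1 + (tsize (enc_default d)).+1.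
  by rewrite -cats1 big_cat big_seq1.
rewrite foldl_rcons -addSn addnA; case: ifP => _; first last.
  by apply: leq_trans IH (leq_addr _ _).
apply: leq_trans (leq_add IH (leqnn _)).
by rewrite /insert; case: ifP => _ /=; lia.
Qed.

Lemma uniq_stageb B j : uniq W -> uniq (stageb B j).
Proof. by move=> uW; elim: j => //= j; apply: uniq_collect. Qed.

Lemma stageb_sub B j : {subset stageb B j <= W ++ map concl D}.
Proof.
elim: j => [|j IH] phi /=; first by rewrite mem_cat => ->.
by move=> /mem_collect[/IH //|[d Dd [_ <-]]]; rewrite mem_cat map_f // orbT.
Qed.

Lemma tsize_forms_sub S : uniq S -> {subset S <= W ++ map concl D} ->
  tsize (enc_forms S) <= tsize (enc_forms W) + tsize (enc_seq enc_default D).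
Proof.
move=> uS /(tsize_enc_subset enc_form uS); rewrite /enc_forms => /leq_trans; apply.
rewrite !tsize_enc_seq big_cat big_map /= addSn addnS !ltnS leqW // leq_add2l.
by apply: leq_sum => d _; rewrite /=; lia.
Qed.

Lemma uniq_approx k : uniq W -> uniq (approx k).
Proof. by case: k => // k; apply: uniq_stageb. Qed.

Lemma approx_sub k : {subset approx k <= W ++ map concl D}.
Proof. by case: k => [phi|k]; [rewrite mem_cat => -> | apply: stageb_sub]. Qed.

Lemma activeP S d : reflect (active [set` S] d) (activeb S d).
Proof.
rewrite /activeb; apply: (iffP and3P) => [[/asboolP h1 /asboolPn h2 /asboolPn h3]|[h1 h2 h3]].
  by split.
by split; [apply/asboolP|apply/asboolPn|apply/asboolPn].
Qed.

(** Equality of sets, rather than equivalence, identifies the queries made on lists with the tests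
    that [tests_in] puts in [K]. *)
Lemma stage_stageb F j :
  stage [set` D] [set` W] (rel_of T) [set` F] j = [set` stageb (unblocked D F) j].
Proof.
elim: j => [|j IH] //; rewrite stageS IH; set S := stageb _ j.
have firesP d : d \in D -> reflect
   [/\ entails [set` S] (prereq d), ~ entails [set` F] (Not (just d)) &
       topmost [set` D] (rel_of T) [set` S] d] (firesb (unblocked D F) S d).
  move=> Dd; rewrite /firesb mem_filter Dd andbT.
  apply: (iffP and3P) => [[/asboolPn h1 /asboolP h2 h3]|[h1 h2 h3]]; split=> //.
  - move=> [d' [Dd' Td' act]]; move/hasP: h3; apply; exists (d', d) => //=.
    by rewrite eqxx mem_filter Dd' andbT; apply/activeP.
  - exact/asboolPn.
  - exact/asboolP.
  - apply/hasP => -[[d1 d2] /= Tx /andP[/eqP e]]; rewrite mem_filter => /andP[/activeP act D1].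
    by apply: h3; exists d1; split=> //; rewrite /rel_of -e.
apply/seteqP; split=> phi /=.
- move=> [h|[d [Dd e h1 h2 h3]]]; apply/mem_collect; first by left.
  by right; exists d => //; split=> //; apply/firesP.
- move=> /mem_collect[h|[d Dd [/(firesP _ Dd)[h1 h2 h3] e]]]; first by left.
  by right; exists d.
Qed.


Lemma approx_Cn E k : strict_total_order_on [set` D] (rel_of T) ->
  preferred_BH [set` D] [set` W] (rel_of T) E ->
  Cn [set` approx k] = Cn (stage [set` D] [set` W] (rel_of T) E k).
Proof.
move=> order prefE; elim: k => [|k IH] //.
(* [approx k.+1] is stage [k + 1] of the candidate [approx k], the last index that [stage_approx]
   covers. *)
by rewrite -[approx _]/(stageb (unblocked D (approx k)) k.+1) -stage_stageb
  (stage_approx order prefE IH).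
Qed.

(** The right-hand side does not depend on [E], whence uniqueness. *)
Lemma ext_approx E : strict_total_order_on [set` D] (rel_of T) ->
  preferred_BH [set` D] [set` W] (rel_of T) E -> E = Cn [set` approx (size D)].
Proof. by move=> order prefE; rewrite (approx_Cn _ order prefE); apply: ext_stage_size. Qed.

(** The queries made on an approximation to find the unblocked defaults are thereby tests on a stage
    of some candidate. *)
Lemma approx_stage k : exists F, [set` approx k] = stage [set` D] [set` W] (rel_of T) F k.
Proof.
case: k => [|k]; first by exists set0.
by exists [set` approx k]; rewrite stage_stageb.
Qed.

End Algorithm.

(** * Running time of the algorithm *)

Section Entailment.
Variables (K : set (set formula * formula)) (K_ptime : ptime_entailment K).

Definition queries_in (S : seq formula) (d : default) : Prop :=
  [/\ K ([set` S], prereq d), K ([set` S], Not (just d)) & K ([set` S], concl d)].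

Section Family.
Variables (I : Type) (P : I -> Prop) (f : I -> tree) (S : I -> seq formula).
Hypothesis f_S : ptime P f (fun i => enc_forms (S i)).
Hypothesis uniqS : forall i, P i -> uniq (S i).

(** The only place where the program for [K] is run. Its bound is in the lengths of formulae, which
    are at most the sizes of their trees. *)
Lemma ptime_entails (phi : I -> formula) :
  (forall i, P i -> K ([set` S i], phi i)) -> ptime P f (fun i => enc_form (phi i)) ->
  ptime P f (fun i => enc_bool (entailsb (S i) (phi i))).
Proof.
move=> inK f_phi; apply: ptime_trans (ptime_node f_S f_phi) _.
case: K_ptime => p [q hp].
apply: (@ptime_intro _ _ p _ _ (fun i => q.[tsize (Node (enc_forms (S i)) (enc_form (phi i)))])%R).
  exact: polybd_horner.
move=> i Pi; have [b hb] := hp _ _ (uniqS Pi) (inK _ Pi).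
have -> : b = entailsb (S i) (phi i) by apply/idP/asboolP => /hb.
apply: computes_within_le; apply: horner_mono.
by have := forms_size_le_tsize (S i); have := flength_le_tsize (phi i); rewrite tsize_Node; lia.
Qed.

Variable d : I -> default.
Hypothesis f_d : ptime P f (fun i => enc_default (d i)).
Hypothesis queries : forall i, P i -> queries_in (S i) (d i).

Lemma ptime_entails_prereq : ptime P f (fun i => enc_bool (entailsb (S i) (prereq (d i)))).
Proof. by apply: ptime_entails (ptime_prereq f_d) => i /queries[]. Qed.

Lemma ptime_entails_notjust :
  ptime P f (fun i => enc_bool (entailsb (S i) (Not (just (d i))))).
Proof. by apply: ptime_entails (ptime_notjust f_d) => i /queries[]. Qed.

Lemma ptime_active : ptime P f (fun i => enc_bool (activeb (S i) (d i))).
Proof.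
apply: ptime_and ptime_entails_prereq _; apply: ptime_and (ptime_not ptime_entails_notjust) _.
by apply: ptime_not; apply: ptime_entails (ptime_concl f_d) => i /queries[].
Qed.

End Family.

Section Iteration.
Variables (I : Type) (P : I -> Prop) (f : I -> tree).
Variables (D : I -> seq default) (T : I -> seq (default * default)).
Hypothesis f_D : ptime P f (fun i => enc_seq enc_default (D i)).
Hypothesis f_T : ptime P f (fun i => enc_seq (enc_pair enc_default enc_default) (T i)).

Lemma ptime_unblocked (S : I -> seq formula) :
  ptime P f (fun i => enc_forms (S i)) -> (forall i, P i -> uniq (S i)) ->
  (forall i d, P i -> d \in D i -> queries_in (S i) d) ->
  ptime P f (fun i => enc_seq enc_default (unblocked (D i) (S i))).
Proof.
move=> f_S uS inK; apply: ptime_filter f_D _; apply: ptime_not.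
apply: (ptime_entails_notjust (elt_lift _ _ f_S) _ (elt_elt _ _ _ _)).
- by move=> x [/uS].
- by move=> x [] /inK; apply.
Qed.

Lemma ptime_fires (B : I -> seq default) (S : I -> seq formula) (d : I -> default) :
  ptime P f (fun i => enc_seq enc_default (B i)) ->
  ptime P f (fun i => enc_forms (S i)) -> ptime P f (fun i => enc_default (d i)) ->
  (forall i, P i -> uniq (S i)) ->
  (forall i, P i -> d i \in D i) ->
  (forall i d, P i -> d \in D i -> queries_in (S i) d) ->
  ptime P f (fun i => enc_bool (firesb (D i) (T i) (B i) (S i) (d i))).
Proof.
move=> f_B f_S f_d uS dD inK.
apply: ptime_and; first exact: (ptime_mem f_B enc_default_inj f_d).
apply: ptime_and; first by apply: ptime_entails_prereq => // i Pi; apply: inK => //; apply: dD.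
(* The active defaults are first selected from [D], so that every query concerns a member of [D];
   scanning [T] then takes only equality tests. *)
have f_A : ptime P f (fun i => enc_seq enc_default (filter (activeb (S i)) (D i))).
  apply: ptime_filter f_D _.
  apply: (ptime_active (elt_lift _ _ f_S) _ (elt_elt _ _ _ _)).
  - by move=> x [/uS].
  - by move=> x [] /inK; apply.
apply: ptime_not.
apply: (ptime_has f_T (p := fun i x => (x.2 == d i) && (x.1 \in filter (activeb (S i)) (D i)))).
have e_x := elt_elt P (enc_pair enc_default enc_default) T f.
apply: ptime_and.
  exact: (ptime_eq enc_default_inj (ptime_right e_x) (elt_lift _ _ f_d)).
exact: (ptime_mem (elt_lift _ _ f_A) enc_default_inj (ptime_left e_x)).
Qed.

End Iteration.

Section Collect.
Variables (I : Type) (P : I -> Prop) (f : I -> tree).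
Variables (D B : I -> seq default) (T : I -> seq (default * default)) (S : I -> seq formula).
Hypothesis f_D : ptime P f (fun i => enc_seq enc_default (D i)).
Hypothesis f_T : ptime P f (fun i => enc_seq (enc_pair enc_default enc_default) (T i)).
Hypothesis f_B : ptime P f (fun i => enc_seq enc_default (B i)).
Hypothesis f_S : ptime P f (fun i => enc_forms (S i)).
Hypothesis uniqS : forall i, P i -> uniq (S i).
Hypothesis queries : forall i d, P i -> d \in D i -> queries_in (S i) d.

Lemma ptime_collect :
  ptime P f (fun i => enc_forms (collect (D i) (T i) (B i) (S i) (D i))).
Proof.
pose acc i l1 := enc_forms (collect (D i) (T i) (B i) (S i) l1).
apply: (ptime_fold (acc := acc) f_D) => //.
  apply: (fold_acc_bounded_by (polybd_add (ptime_size f_S) (ptime_size f_D))) => i l1 l2 _ e.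
  apply: leq_trans (tsize_collect _ _ _ _ _) _.
  by rewrite leq_add2l e tsize_enc_catr.
set Q := fold_dom _ _; set ctx := fold_ctx _ _ _.
have c_acc : ptime Q ctx (fun x => acc x.1 x.2.1) := ctx_acc _ _ _ _ _.
have c_d : ptime Q ctx (fun x => enc_default x.2.2) := ctx_elt _ _ _ _ _.
have c_fires : ptime Q ctx
    (fun x => enc_bool (firesb (D x.1) (T x.1) (B x.1) (S x.1) x.2.2)).
  apply: (ptime_fires (ctx_lift _ _ _ f_D) (ctx_lift _ _ _ f_T) (ctx_lift _ _ _ f_B)
    (ctx_lift _ _ _ f_S) c_d).
  - by move=> x [/uniqS].
  - by move=> x [_ [l2 ->]]; rewrite mem_cat mem_head orbT.
  - by move=> x d [/queries h _]; apply: h.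
apply: ptime_ext (ptime_choose c_fires (ptime_choose
  (ptime_mem c_acc enc_form_inj (ptime_concl c_d)) c_acc
  (ptime_node (ptime_concl c_d) c_acc)) c_acc) => x _ /=.
rewrite /acc /collect foldl_rcons; case: (firesb _ _ _ _ _) => //.
by rewrite /insert; case: ifP.
Qed.

End Collect.

Section Stages.
Variables (I A : Type) (P : I -> Prop) (f : I -> tree) (enc : A -> tree) (l : I -> seq A).
Variables (D B : I -> seq default) (T : I -> seq (default * default)) (W : I -> seq formula).
Hypothesis f_l : ptime P f (fun i => enc_seq enc (l i)).
Hypothesis f_D : ptime P f (fun i => enc_seq enc_default (D i)).
Hypothesis f_T : ptime P f (fun i => enc_seq (enc_pair enc_default enc_default) (T i)).
Hypothesis f_B : ptime P f (fun i => enc_seq enc_default (B i)).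
Hypothesis f_W : ptime P f (fun i => enc_forms (W i)).
Hypothesis uniqW : forall i, P i -> uniq (W i).
Hypothesis queries : forall i d j, P i -> d \in D i ->
  queries_in (stageb (D i) (W i) (T i) (B i) j) d.

(** Iteration is a fold along a list, so [l] serves as a unary counter of stages. *)
Lemma ptime_stage : ptime P f (fun i => enc_forms (stageb (D i) (W i) (T i) (B i) (size (l i)))).
Proof.
pose acc i (l1 : seq A) := enc_forms (stageb (D i) (W i) (T i) (B i) (size l1)).
apply: (ptime_fold (acc := acc) f_l) => //.
  exists (sval (cid (polybd_add (ptime_size f_W) (ptime_size f_D)))) => i l1 l2 Pi _.
  case: cid => k hk /=; apply: leq_trans (hk _ Pi).
  by apply: tsize_forms_sub; [apply: uniq_stageb; apply: uniqW | apply: stageb_sub].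
set Q := fold_dom _ _; set ctx := fold_ctx _ _ _.
have c_acc : ptime Q ctx (fun x => acc x.1 x.2.1) := ctx_acc _ _ _ _ _.
apply: ptime_ext (ptime_collect (ctx_lift _ _ _ f_D) (ctx_lift _ _ _ f_T)
  (ctx_lift _ _ _ f_B) c_acc _ _) => x.
- by rewrite /acc size_rcons.
- by move=> [/uniqW uW _]; apply: uniq_stageb.
- by move=> d [Px _]; apply: queries.
Qed.

End Stages.
End Entailment.

(** * Uniqueness and computation of the extension *)

Definition theory : Type := seq default * seq formula * seq (default * default).

Lemma ptime_approx (K : set (set formula * formula)) : ptime_entailment K ->
  ptime (fun x : theory => K_instance K x.1.1 x.1.2 x.2)
    (fun x => enc_theory x.1.1 x.1.2 x.2)
    (fun x => enc_forms (approx x.1.1 x.1.2 x.2 (size x.1.1))).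
Proof.
move=> K_ptime; set P := fun x : theory => _; set f := fun x : theory => enc_theory _ _ _.
have f_D : ptime P f (fun x => enc_seq enc_default x.1.1) := ptime_left (ptime_id _ _).
have f_W : ptime P f (fun x => enc_forms x.1.2) := ptime_left (ptime_right (ptime_id _ _)).
have f_T : ptime P f (fun x => enc_seq (enc_pair enc_default enc_default) x.2) :=
  ptime_right (ptime_right (ptime_id _ _)).
pose F (x : theory) k := approx x.1.1 x.1.2 x.2 k.
have uF x k : P x -> uniq (F x k) by case=> _ uW _ _ _; apply: uniq_approx.
have stage_queries x E S j d : P x -> d \in x.1.1 ->
    [set` S] = stage [set` x.1.1] [set` x.1.2] (rel_of x.2) E j -> queries_in K S d.
  by move=> [_ _ _ _ inK] Dd e; rewrite /queries_in e; apply: inK.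
(* The processed defaults are kept, reversed, as a unary counter: the next approximation is a stage
   whose index is one more than the length of this list. *)
pose acc x (l1 : seq default) :=
  Node (enc_seq enc_default (rev l1)) (enc_forms (F x (size l1))).
suff h : ptime P f (fun x => acc x x.1.1) by apply: ptime_right h.
apply: (ptime_fold (acc := acc) f_D).
- exact: ptime_node (ptime_const _ _ _) f_W.
- case: (polybd_add (polybd_const P (fun x => tsize (f x)) 1) (polybd_add (ptime_size f_D)
    (polybd_add (ptime_size f_W) (ptime_size f_D)))) => k hk.
  exists k => x l1 l2 Px e; apply: leq_trans (hk _ Px).
  rewrite /acc tsize_Node add1n ltnS leq_add //.
    by rewrite tsize_enc_rev e tsize_enc_catr.
  by apply: tsize_forms_sub; [apply: uF | apply: approx_sub].
set Q := fold_dom _ _; set ctx := fold_ctx _ _ _.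
have c_acc : ptime Q ctx (fun x => acc x.1 x.2.1) := ctx_acc _ _ _ _ _.
have c_d : ptime Q ctx (fun x => enc_default x.2.2) := ctx_elt _ _ _ _ _.
have c_l : ptime Q ctx (fun x => enc_seq enc_default (rev (rcons x.2.1 x.2.2))).
  apply: ptime_ext (ptime_node c_d (ptime_left c_acc)) => x _.
  by rewrite rev_rcons.
have c_D := ctx_lift enc_default (fun x => x.1.1) acc f_D.
have c_W := ctx_lift enc_default (fun x => x.1.1) acc f_W.
have c_T := ctx_lift enc_default (fun x => x.1.1) acc f_T.
have c_B : ptime Q ctx (fun x => enc_seq enc_default (unblocked x.1.1.1 (F x.1 (size x.2.1)))).
  apply: (ptime_unblocked K_ptime c_D (ptime_right c_acc)).
  - by move=> x [Px _]; apply: uF.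
  - move=> x d [Px _] Dd.
    have [E hE] := approx_stage x.1.1.1 x.1.1.2 x.1.2 (size x.2.1).
    exact: stage_queries hE.
apply: (ptime_node c_l).
apply: ptime_ext (ptime_stage K_ptime c_l c_D c_T c_B c_W _ _) => x.
- by rewrite size_rev size_rcons.
- by move=> [[_ uW _ _ _] _].
- move=> d j [Px _] Dd; apply: stage_queries Dd _ => //.
  by rewrite -stage_stageb.
Qed.

Unset Implicit Arguments.

Theorem theorem4p8 (K : set (set formula * formula))
  (K_finite : forall (S : set formula) (phi : formula), K (S, phi) -> finite_set S)
  (K_ptime : ptime_entailment K) :
  (forall (D : seq default) (W : seq formula) (T : seq (default * default)),
     K_instance K D W T ->
     forall E E' : set formula,
       preferred_BH [set` D] [set` W] (rel_of T) E ->
       preferred_BH [set` D] [set` W] (rel_of T) E' -> E = E')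
  /\
  (exists (p : cmd) (q : {poly nat}),
     forall (D : seq default) (W : seq formula) (T : seq (default * default)),
       K_instance K D W T ->
       forall E : set formula,
         preferred_BH [set` D] [set` W] (rel_of T) E ->
         exists G : seq formula,
           [/\ uniq G, E = Cn [set` G] &
               computes_within p (enc_theory D W T) (enc_forms G)
                 (q.[(theory_size D W + order_size T)%N])%R]).
Proof.
split=> [D W T [_ _ _ order _] E E' prefE prefE'|].
  by rewrite (ext_approx order prefE) (ext_approx order prefE').
have [p [k hp]] := ptime_approx K_ptime.
(* The encoded input has at most [20 * N + 5] nodes, where [N] is the size of theory and order
   together, and the time bound is a power of the number of nodes plus 2. *)
exists p, ((20%:P * 'X + 7%:P) ^+ k)%R => D W T inst E prefE.
case: (inst) => _ uW _ order _; exists (approx D W T (size D)); split.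
- exact: uniq_approx.
- exact: ext_approx.
- apply: computes_within_le (hp (D, W, T) inst).
  rewrite horner_exp hornerD hornerM !hornerC hornerX natrXE.
  rewrite [X in _ <= X ^ _](_ : _ = (20 * (theory_size D W + order_size T) + 5).+2).
    exact: leq_pow2 (tsize_enc_theory D W T) (leqnn k).
  by rewrite -!addnS !natrE.
Qed.
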